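(* Consider the multi-queue bandit described in the context, with any problem instance $(\boldsymbol\lambda,\boldsymbol\mu)$ with a unique optimal matching, any $\alpha\in(0,1)$ and any $\alpha$-consistent policy. Let $D(\boldsymbol\mu)=\frac{\Delta}{\mathrm{KL}\left(\mu_{\min},\frac{\mu_{\max}+1}{2}\right)}$. Then (a) $\displaystyle \frac1U\sum_{u\in[U]}\Psi_u(t)\ge\left(\frac{\lambda_{\min}}{8}D(\boldsymbol\mu)(1-\alpha)(K-1)\right)\frac1t$ for infinitely many $t$; and (b) for any $u\in[U]$, $\displaystyle \Psi_u(t)\ge\left(\frac{\lambda_{\min}}{8}D(\boldsymbol\mu)(1-\alpha)\max\{U-1,2(K-U)\}\right)\frac1t$ for infinitely many $t$.
   Context: Discrete-time system with $U$ queues and $K$ servers, $1\le U\le K$. Arrivals $A_u(t)\in\{0,1\}$ to queue $u$ are Bernoulli($\lambda_u$), and the service $R_{uk}(t)\in\{0,1\}$ that server $k$ offers queue $u$ at time $t$ is Bernoulli($\mu_{uk}$); all mutually independent and i.i.d. across slots. In each slot a policy schedules a matching between queues and servers (each server serves at most one queue, each queue at most one server), based only on past observations (scheduled matchings, observed services, arrivals) and independent internal randomness; the parameters are unknown. $\kappa_u(t)$ is the server assigned to queue $u$, $S_u(t)=R_{u\kappa_u(t)}(t)$ (0 if unassigned), $Q_u(t)=(Q_u(t-1)+A_u(t)-S_u(t))^+$. Unique optimal matching: for each $u$, $\mu^*_u=\max_k\mu_{uk}$ is attained at a unique $k^*_u$, and $k^*_u\ne k^*_{u'}$ for $u\ne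 u'$; stability: $\epsilon_u=\mu^*_u-\lambda_u>0$ for all $u$. The genie queue $Q^*_u$ uses the same arrivals and always server $k^*_u$. $Q_u(0)$ and $Q^*_u(0)$ are distributed according to the stationary distribution of $Q^*_u$. Regret: $\Psi_u(t)=\mathbb{E}[Q_u(t)-Q^*_u(t)]$. Notation: $\Delta=\min_{u,\,k\ne k^*_u}(\mu^*_u-\mu_{uk})$, $\mu_{\min}=\min_{u,k}\mu_{uk}$, $\mu_{\max}=\max_{u,k}\mu_{uk}$, $\lambda_{\min}=\min_u\lambda_u$, $\mathrm{KL}(p,q)=p\log\frac pq+(1-p)\log\frac{1-p}{1-q}$. With $T_{uk}(t)=\sum_{s=1}^t\mathbf 1\{\kappa_u(s)=k\}$, a policy is $\alpha$-consistent if for every problem instance satisfying these assumptions, $\mathbb{E}[T_{uk}(t)]=O(t^\alpha)$ for every $u$ and every $k\ne k^*_u$. *)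

(* Defs.v *)
From HB Require Import structures.
From mathcomp Require Import all_boot all_order all_algebra.
From mathcomp Require Import all_classical all_reals all_analysis.
Set Implicit Arguments. Unset Strict Implicit. Unset Printing Implicit Defensive.
Import Order.TTheory GRing.Theory Num.Theory.
Local Open Scope ring_scope.

Section QueueBandit.
Variables (U K : nat).

Definition is_matching (m : {ffun 'I_U -> option 'I_K}) : bool :=
  [forall u, forall v, (u != v) ==> (m u != None) ==> (m u != m v)].

Definition matching := {m : {ffun 'I_U -> option 'I_K} | is_matching m}.

(* One slot: scheduled matching, arrivals A_u(t), services R_{uk}(t). *)
Definition step := (matching * ({ffun 'I_U -> bool} * {ffun 'I_U -> {ffun 'I_K -> bool}}))%type.

(* What the policy observes in one slot: the matching, the arrivals and the
   services S_u(t) = R_{u kappa_u(t)}(t) (0 if u unassigned). *)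
Definition obs := (matching * ({ffun 'I_U -> bool} * {ffun 'I_U -> bool}))%type.

Definition served (m : matching) (r : {ffun 'I_U -> {ffun 'I_K -> bool}}) (u : 'I_U) : bool :=
  match val m u with Some k => r u k | None => false end.

Definition observe (x : step) : obs :=
  (x.1, (x.2.1, [ffun u => served x.1 x.2.2 u])).

Variable R : realType.

(* A (randomized) policy: given the history of past observations (in
   chronological order), a probability distribution over matchings. *)
Definition policy := seq obs -> matching -> R.

Definition valid_policy (pol : policy) : Prop :=
  (forall h m, 0 <= pol h m) /\ (forall h, \sum_(m : matching) pol h m = 1).

Definition bern (p : R) (b : bool) : R := if b then p else 1 - p.

Fixpoint traj_prob (pol : policy) (lam : 'I_U -> R) (mu : 'I_U -> 'I_K -> R)
    (h : seq obs) (w : seq step) : R :=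
  match w with
  | [::] => 1
  | x :: w' =>
      pol h x.1 * (\prod_(u < U) bern (lam u) (x.2.1 u))
        * (\prod_(u < U) \prod_(k < K) bern (mu u k) (x.2.2 u k))
        * traj_prob pol lam mu (rcons h (observe x)) w'
  end.

Definition Exp (pol : policy) lam mu (t : nat) (F : seq step -> R) : R :=
  \sum_(w : t.-tuple step) traj_prob pol lam mu [::] w * F w.

(* Q_u(t) = (Q_u(t-1) + A_u(t) - S_u(t))^+  (truncated nat subtraction). *)
Definition Qlen (u : 'I_U) (q0 : nat) (w : seq step) : nat :=
  foldl (fun q (x : step) => (q + x.2.1 u - served x.1 x.2.2 u)%N) q0 w.

Definition Qstar (kstar : 'I_U -> 'I_K) (u : 'I_U) (q0 : nat) (w : seq step) : nat :=
  foldl (fun q (x : step) => (q + x.2.1 u - x.2.2 u (kstar u))%N) q0 w.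

Definition Tcount (u : 'I_U) (k : 'I_K) (w : seq step) : nat :=
  count (fun x : step => val x.1 u == Some k) w.

(* Problem instance assumptions: Bernoulli parameters, unique optimal
   matching given by kstar, stability. *)
Definition instance_ok (lam : 'I_U -> R) (mu : 'I_U -> 'I_K -> R)
    (kstar : 'I_U -> 'I_K) : Prop :=
  (forall u, 0 <= lam u <= 1) /\ (forall u k, 0 <= mu u k <= 1) /\
  (forall u k, k != kstar u -> mu u k < mu u (kstar u)) /\
  injective kstar /\
  (forall u, lam u < mu u (kstar u)).

Definition consistent (alpha : R) (pol : policy) : Prop :=
  forall lam mu kstar, instance_ok lam mu kstar ->
  forall u k, k != kstar u ->
  exists C : R, exists N : nat, forall t : nat, (N <= t)%N ->
    Exp pol lam mu t (fun w => (Tcount u k w)%:R) <= C * (t%:R `^ alpha).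

Definition qkernel (la m : R) (i j : nat) : R :=
  \sum_(a : bool) \sum_(s : bool) bern la a * bern m s * ((i + a - s)%N == j)%:R.

Local Open Scope ereal_scope.

Definition stationary (la m : R) (pi : nat -> R) : Prop :=
  (forall n, (0 <= pi n)%R) /\
  (\sum_(n <oo) (pi n)%:E = 1%:E) /\
  (forall j, (pi j)%:E = \sum_(i <oo) (pi i * qkernel la m i j)%:E).

(* Regret Psi_u(t) = E[Q_u(t)] - E[Q*_u(t)], with Q_u(0), Q*_u(0) ~ pi_u,
   independent of arrivals, services and the policy's randomness. *)
Definition Psi (pol : policy) lam mu (kstar : 'I_U -> 'I_K) (pi : 'I_U -> nat -> R)
    (u : 'I_U) (t : nat) : \bar R :=
  \sum_(q <oo) (pi u q * Exp pol lam mu t (fun w => (Qlen u q w)%:R))%:E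
  - \sum_(q <oo) (pi u q * Exp pol lam mu t (fun w => (Qstar kstar u q w)%:R))%:E.

Local Close Scope ereal_scope.

(* Kullback-Leibler divergence of Bernoullis, with values in \bar R and the
   usual conventions 0 log 0 = 0, p log (p/0) = +oo for p > 0. *)
Definition KLb (p q : R) : \bar R :=
  if ((q == 0) && (0 < p)) || ((q == 1) && (p < 1)) then +oo%E
  else (p * ln (p / q) + (1 - p) * ln ((1 - p) / (1 - q)))%:E.

Definition mu_min (mu : 'I_U -> 'I_K -> R) : R :=
  \big[Num.min/1]_(p : 'I_U * 'I_K) mu p.1 p.2.
Definition mu_max (mu : 'I_U -> 'I_K -> R) : R :=
  \big[Num.max/0]_(p : 'I_U * 'I_K) mu p.1 p.2.
Definition lam_min (lam : 'I_U -> R) : R := \big[Num.min/1]_(u < U) lam u.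
(* Delta = min_{u, k != k*_u} (mu*_u - mu_uk); the range is empty only when
   K = 1, in which case the bounds have a zero factor anyway. *)
Definition Delta (mu : 'I_U -> 'I_K -> R) (kstar : 'I_U -> 'I_K) : R :=
  \big[Num.min/1]_(p : 'I_U * 'I_K | p.2 != kstar p.1) (mu p.1 (kstar p.1) - mu p.1 p.2).

(* D(mu) = Delta / KL(mu_min, (mu_max+1)/2), with Delta / +oo = 0. *)
Definition Dmu (mu : 'I_U -> 'I_K -> R) (kstar : 'I_U -> 'I_K) : R :=
  let kl := KLb (mu_min mu) ((mu_max mu + 1) / 2) in
  if kl is (x%:E)%E then Delta mu kstar / x else 0.

End QueueBandit.

(* Main.v *)
(* Given the past, the service offered to queue u by the policy is Bernoulli
   with a parameter at most mu*_u. One slot of the queue acts on functions of the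
   queue length by an operator that preserves monotonicity and decreases in the
   service rate, so Psi_u(t) >= lambda_u Delta P(kappa_u(t) <> k*_u); here the
   stationary law is geometric, so that E[Q*_u(t)] is finite.

   Raising mu_uk to q = (mu_max + 1) / 2 for a server k that is optimal for no
   queue, or raising both mu_{u,k*_u'} and mu_{u',k*_u}, gives an instance whose
   optimal matching differs from k* at u. A consistent policy must tell it from
   the original one, and the change-of-measure inequality forces the expected
   number of uses of the raised pairs to be at least of order
   (1 - alpha) log t / KL(mu_min, q). Whenever queue u uses a raised server, or
   another queue uses k*_u, queue u is not served by k*_u; summing over the
   perturbations bounds from below the expected number of slots up to t in which
   u misses k*_u. If Psi_u(t) < c / t held for all large t, this number would be
   at most of order c log t, with a smaller constant. *)

Require Import Defs.
From HB Require Import structures.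
From mathcomp Require Import all_boot all_order all_algebra.
From mathcomp Require Import all_classical all_reals all_analysis.
From mathcomp Require Import perm ring lra zify.
Import Order.TTheory GRing.Theory Num.Theory.
Local Open Scope ring_scope.

Set Implicit Arguments.
Unset Strict Implicit.
Unset Printing Implicit Defensive.

(** * Expectations along a controlled random process, and change of measure *)

Section ControlledProcess.
Variables (R : realType) (X : finType) (H : Type) (upd : H -> X -> H).

(** With [H] and [upd] abstract, the same lemmas serve both the full trajectories, whose state keeps
    observations only, and the process of observations. *)
Fixpoint expect (p : H -> X -> R) (t : nat) (h : H) (F : seq X -> R) : R :=
  if t is t'.+1 then
    \sum_x p h x * expect p t' (upd h x) (fun w => F (x :: w))
  else F [::].

Lemma expectS p t h F : expect p t.+1 h F =
  \sum_x p h x * expect p t (upd h x) (fun w => F (x :: w)).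
Proof. by []. Qed.

Definition cumul (c : X -> R) (w : seq X) : R := \sum_(x <- w) c x.
Definition last_val (c : X -> R) (w : seq X) : R := last 0 [seq c x | x <- w].

Lemma cumul_cons c x w : cumul c (x :: w) = c x + cumul c w.
Proof. by rewrite /cumul big_cons. Qed.

Section Linear.
Variable p : H -> X -> R.

Lemma eq_expect t h F G :
  (forall w, size w = t -> F w = G w) -> expect p t h F = expect p t h G.
Proof.
elim: t h F G => [|t IH] h F G FG /=; first exact: FG.
apply: eq_bigr => x _; congr (_ * _); apply: IH => w sw.
by apply: FG; rewrite /= sw.
Qed.

Lemma expectD t h F G :
  expect p t h (fun w => F w + G w) = expect p t h F + expect p t h G.
Proof.
elim: t h F G => [|t IH] h F G //=; rewrite -big_split /=.
by apply: eq_bigr => x _; rewrite IH mulrDr.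
Qed.

Lemma expectZ t h a F :
  expect p t h (fun w => a * F w) = a * expect p t h F.
Proof.
elim: t h F => [|t IH] h F //=; rewrite big_distrr /=.
by apply: eq_bigr => x _; rewrite IH mulrCA.
Qed.

Lemma expect_sum (I : finType) (P : pred I) t h (F : I -> seq X -> R) :
  expect p t h (fun w => \sum_(i | P i) F i w)
  = \sum_(i | P i) expect p t h (F i).
Proof.
elim: t h F => [|t IH] h F //=; rewrite exchange_big /=.
by apply: eq_bigr => x _; rewrite IH big_distrr.
Qed.

Hypothesis p_ge0 : forall h x, 0 <= p h x.

Lemma le_expect t h F G :
  (forall w, size w = t -> F w <= G w) -> expect p t h F <= expect p t h G.
Proof.
elim: t h F G => [|t IH] h F G FG /=; first exact: FG.
apply: ler_sum => x _; apply: ler_wpM2l; first exact: p_ge0.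
by apply: IH => w sw; apply: FG; rewrite /= sw.
Qed.

Lemma expect_ge0 t h F : (forall w, 0 <= F w) -> 0 <= expect p t h F.
Proof.
elim: t h F => [|t IH] h F F0 //=.
by apply: sumr_ge0 => x _; apply: mulr_ge0 => //; apply: IH.
Qed.

Hypothesis p_sum1 : forall h, \sum_x p h x = 1.

Lemma expect_cst t h c : expect p t h (fun=> c) = c.
Proof.
elim: t h => [|t IH] h //=.
by under eq_bigr do rewrite IH; rewrite -mulr_suml p_sum1 mul1r.
Qed.

(** Later slots have total mass 1 and leave earlier costs alone, so a longer horizon adds exactly
    the mean cost of its last slot. *)
Lemma expect_cumulS t h c :
  expect p t.+1 h (cumul c)
  = expect p t h (cumul c) + expect p t.+1 h (last_val c).
Proof.
elim: t h => [|t IH] h.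
  rewrite /= /cumul big_nil add0r; apply: eq_bigr => x _.
  by rewrite big_cons big_nil addr0.
rewrite [in LHS]/= [X in _ = X + _]/= [X in _ = _ + X]/= -big_split /=.
apply: eq_bigr => x _; rewrite -mulrDr; congr (_ * _).
have E n h' : expect p n h' (fun w => cumul c (x :: w))
    = c x + expect p n h' (cumul c).
  rewrite -[c x in RHS](expect_cst n h') -expectD.
  by apply: eq_expect => w _; rewrite cumul_cons.
have := IH (upd h x); rewrite -!/(expect _ _.+1 _ _) => IHx.
transitivity (expect p t.+1 (upd h x) (fun w => cumul c (x :: w))) => //.
rewrite !E IHx -addrA; congr (_ + (_ + _)).
Qed.

(** Costs are compared through their conditional means, slot by slot; this suits log-likelihood
    ratios, which are bounded in mean but not pointwise. *)
Lemma le_expect_cumul t h c c' :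
  (forall h, \sum_x p h x * c x <= \sum_x p h x * c' x) ->
  expect p t h (cumul c) <= expect p t h (cumul c').
Proof.
move=> cc'; elim: t h => [|t IH] h; first by rewrite /= /cumul !big_nil.
have E (d : X -> R) : expect p t.+1 h (cumul d) =
    \sum_x p h x * d x + \sum_x p h x * expect p t (upd h x) (cumul d).
  rewrite /= -big_split /=; apply: eq_bigr => x _; rewrite -mulrDr.
  congr (_ * _); rewrite -[d x in RHS](expect_cst t (upd h x)) -expectD.
  by apply: eq_expect => w _; rewrite cumul_cons.
rewrite !E lerD //; apply: ler_sum => x _; exact: ler_wpM2l.
Qed.

End Linear.

Section ChangeOfMeasure.
Variables (p p' : H -> X -> R) (l : X -> R).
Hypothesis p_ge0 : forall h x, 0 <= p h x.
Hypothesis p'_ge0 : forall h x, 0 <= p' h x.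
Hypothesis pp' : forall h x, p h x * expR (- l x) <= p' h x.

(** The hypothesis on the kernels is an inequality, since the likelihood-ratio identity breaks down
    where [p] vanishes. *)
Lemma expect_tilt t h G : (forall w, 0 <= G w) ->
  expect p t h (fun w => expR (- cumul l w) * G w) <= expect p' t h G.
Proof.
elim: t h G => [|t IH] h G G0 /=.
  by rewrite /cumul big_nil oppr0 expR0 mul1r.
apply: ler_sum => x _.
under eq_expect do rewrite cumul_cons opprD expRD -mulrA.
rewrite expectZ mulrA.
have Ep' : 0 <= expect p' t (upd h x) (fun w => G (x :: w)).
  exact: expect_ge0.
apply: (@le_trans _ _ (p h x * expR (- l x)
  * expect p' t (upd h x) (fun w => G (x :: w)))).
  by apply: ler_wpM2l; [rewrite mulr_ge0 ?expR_ge0 | exact: IH].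
exact: ler_wpM2r.
Qed.

(* The Donsker-Varadhan inequality, with its logarithm linearised by
   [1 + y <= exp y]. *)
Lemma expect_change_measure t h F :
  expect p t h (fun w => 1 + (F w - cumul l w))
  <= expect p' t h (fun w => expR (F w)).
Proof.
apply: le_trans (expect_tilt t h (fun w => expR_ge0 (F w))).
apply: le_expect => // w _; rewrite -expRD.
by rewrite [- _ + _]addrC expR_ge1Dx.
Qed.

End ChangeOfMeasure.
End ControlledProcess.

(** * Product laws on finite functions *)

Section ProductLaw.
Variables (R : realType) (I J : finType) (f : I -> J -> R).

(** Functions with the same image form a product of fibres, so coordinatewise maps preserve
    independence. *)
Lemma sum_prod_pushforward (B : finType) (c : I -> J -> B)
    (G : {ffun I -> B} -> R) :
  \sum_(g : {ffun I -> J}) (\prod_i f i (g i)) * G [ffun i => c i (g i)]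
  = \sum_(s : {ffun I -> B}) (\prod_i \sum_(j | c i j == s i) f i j) * G s.
Proof.
rewrite (partition_big (fun g : {ffun I -> J} => [ffun i => c i (g i)])
  predT) //=.
apply: eq_bigr => s _; rewrite bigA_distr_big_dep big_distrl /=.
apply: eq_big => [g|g /eqP-> //].
apply/eqP/familyP => [<- i|gs].
  by rewrite unfold_in /= ffunE.
by apply/ffunP => i; rewrite ffunE; apply/eqP; exact: gs.
Qed.

Hypothesis f_sum1 : forall i, \sum_j f i j = 1.

Lemma sum_prod_marginal (u : I) (phi : J -> R) :
  \sum_(g : {ffun I -> J}) (\prod_i f i (g i)) * phi (g u)
  = \sum_j f u j * phi j.
Proof.
(* [phi] is absorbed into the factor of [u], so that the sum of products becomes a product of
   sums. *)
pose f' i j := f i j * (if i == u then phi j else 1).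
transitivity (\sum_(g : {ffun I -> J}) \prod_i f' i (g i)).
  apply: eq_bigr => g _; rewrite big_split /=; congr (_ * _).
  by rewrite -big_mkcond big_pred1_eq.
rewrite -bigA_distr_bigA (bigD1 u) //= [X in _ * X]big1 => [|i iu].
  by rewrite mulr1; apply: eq_bigr => j _; rewrite /f' eqxx.
by rewrite -(f_sum1 i); apply: eq_bigr => j _; rewrite /f' (negbTE iu) mulr1.
Qed.

Lemma sum_prod1 : \sum_(g : {ffun I -> J}) \prod_i f i (g i) = 1.
Proof. by rewrite -bigA_distr_bigA big1. Qed.

End ProductLaw.

(** * Sums over tuples and pairs, and Bernoulli weights *)

Lemma big_tuple_cons (R : realType) (T : finType) n (F : seq T -> R) :
  \sum_(w : n.+1.-tuple T) F w = \sum_x \sum_(w : n.-tuple T) F (x :: w).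
Proof.
rewrite pair_bigA /=.
rewrite (reindex (fun xw : T * n.-tuple T => [tuple of xw.1 :: xw.2])) //=.
exists (fun w : n.+1.-tuple T => (thead w, [tuple of behead w])).
  by move=> [x w] _ /=; congr (_, _); apply: val_inj.
by move=> w _ /=; rewrite [RHS]tuple_eta.
Qed.

Lemma big_prod_pair (R : realType) (I J : finType) (F : I * J -> R) :
  \sum_x F x = \sum_i \sum_j F (i, j).
Proof. by rewrite pair_bigA /=; apply: eq_bigr => -[]. Qed.

Section Bernoulli.
Variable R : realType.
Implicit Types p : R.

Lemma bern_ge0 p b : 0 <= p <= 1 -> 0 <= bern p b.
Proof. by move=> /andP[? ?]; case: b => //=; rewrite subr_ge0. Qed.

Lemma sum_bern p : \sum_b bern p b = 1.
Proof. by rewrite big_bool /= addrC subrK. Qed.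

End Bernoulli.

(** * One-slot laws of full steps and of observations *)

Section Kernels.
Variables (U K : nat) (R : realType).
Variables (pol : policy U K R) (lam : 'I_U -> R) (mu : 'I_U -> 'I_K -> R).

Definition rate (m : matching U K) (u : 'I_U) : R :=
  if val m u is Some k then mu u k else 0.

Definition step_law (h : seq (obs U K)) (x : step U K) : R :=
  pol h x.1 * (\prod_(u < U) bern (lam u) (x.2.1 u))
    * (\prod_(u < U) \prod_(k < K) bern (mu u k) (x.2.2 u k)).

Definition obs_law (h : seq (obs U K)) (o : obs U K) : R :=
  pol h o.1 * (\prod_(u < U) bern (lam u) (o.2.1 u))
    * (\prod_(u < U) bern (rate o.1 u) (o.2.2 u)).

Definition step_expect := expect (fun h x => rcons h (observe x)) step_law.
Definition obs_expect := expect rcons obs_law.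

Lemma ExpE t F : Exp pol lam mu t F = step_expect t [::] F.
Proof.
rewrite /Exp /step_expect; move: [::] F.
elim: t => [|t IH] h F /=.
  rewrite (bigD1 [tuple]) //= mul1r big1 ?addr0 // => w /negP[].
  by apply/eqP; exact: tuple0.
rewrite (big_tuple_cons t (fun w => traj_prob pol lam mu h w * F w)).
apply: eq_bigr => x _; rewrite -IH big_distrr /=.
by apply: eq_bigr => w _; rewrite mulrA.
Qed.

Lemma sum_step_law h (F : step U K -> R) :
  \sum_x step_law h x * F x = \sum_m pol h m *
    \sum_(a : {ffun 'I_U -> bool}) (\prod_(u < U) bern (lam u) (a u)) *
    \sum_(r : {ffun 'I_U -> {ffun 'I_K -> bool}})
      (\prod_(u < U) \prod_(k < K) bern (mu u k) (r u k)) * F (m, (a, r)).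
Proof.
rewrite big_prod_pair; apply: eq_bigr => m _.
rewrite big_prod_pair big_distrr /=; apply: eq_bigr => a _.
by rewrite !big_distrr /=; apply: eq_bigr => r _; rewrite /step_law /= !mulrA.
Qed.

Lemma sum_obs_law h (F : obs U K -> R) :
  \sum_o obs_law h o * F o = \sum_m pol h m *
    \sum_(a : {ffun 'I_U -> bool}) (\prod_(u < U) bern (lam u) (a u)) *
    \sum_(s : {ffun 'I_U -> bool})
      (\prod_(u < U) bern (rate m u) (s u)) * F (m, (a, s)).
Proof.
rewrite big_prod_pair; apply: eq_bigr => m _.
rewrite big_prod_pair big_distrr /=; apply: eq_bigr => a _.
by rewrite !big_distrr /=; apply: eq_bigr => r _; rewrite /obs_law /= !mulrA.
Qed.

Lemma sum_services1 u :
  \sum_(r : {ffun 'I_K -> bool}) \prod_(k < K) bern (mu u k) (r k) = 1.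
Proof. by apply: (sum_prod1 (f := fun k => bern (mu u k))) => k; exact: sum_bern. Qed.

Definition serve (c : option 'I_K) (r : {ffun 'I_K -> bool}) : bool :=
  if c is Some k then r k else false.

Lemma sum_serve (m : matching U K) u (phi : bool -> R) :
  \sum_(r : {ffun 'I_K -> bool})
     (\prod_(k < K) bern (mu u k) (r k)) * phi (serve (val m u) r)
  = \sum_b bern (rate m u) b * phi b.
Proof.
rewrite /rate /serve; case: (val m u) => [k|].
  by rewrite (sum_prod_marginal (f := fun k => bern (mu u k))) // => i;
    exact: sum_bern.
by rewrite -big_distrl /= sum_services1 big_bool /= mul0r subr0 !mul1r add0r.
Qed.

(** Given the matching, the served bits of different queues come from disjoint rows of services,
    hence are independent. As the policy sees the past through observations alone, these form a
    controlled process of their own. *)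
Lemma step_law_observe h (F : obs U K -> R) :
  \sum_x step_law h x * F (observe x) = \sum_o obs_law h o * F o.
Proof.
rewrite sum_step_law sum_obs_law; apply: eq_bigr => m _; congr (_ * _).
apply: eq_bigr => a _; congr (_ * _).
rewrite /observe /=.
rewrite (sum_prod_pushforward
  (fun u (r : {ffun 'I_K -> bool}) => \prod_(k < K) bern (mu u k) (r k))
  (fun u r => serve (val m u) r) (fun s => F (m, (a, s)))).
apply: eq_bigr => s _; congr (_ * _); apply: eq_bigr => u _.
rewrite big_mkcond /=.
(* The mass of a fibre is computed as the mean of its indicator. *)
transitivity (\sum_b bern (rate m u) b * (b == s u)%:R).
  rewrite -sum_serve; apply: eq_bigr => r _.
  by case: ifP => _; rewrite ?mulr1 ?mulr0.
by rewrite big_bool; case: (s u); rewrite /= ?mulr1 ?mulr0 ?addr0 ?add0r.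
Qed.

Lemma step_expect_observe t h (F : seq (obs U K) -> R) :
  step_expect t h (fun w => F (map (@observe U K) w)) = obs_expect t h F.
Proof.
rewrite /step_expect /obs_expect; elim: t h F => [//|t IH] h F /=.
rewrite -step_law_observe; apply: eq_bigr => x _; congr (_ * _).
by rewrite -IH.
Qed.

Lemma step_law_queue h u (phi : matching U K -> bool -> bool -> R) :
  \sum_x step_law h x * phi x.1 (x.2.1 u) (served x.1 x.2.2 u)
  = \sum_m pol h m * \sum_a bern (lam u) a
      * \sum_b bern (rate m u) b * phi m a b.
Proof.
rewrite sum_step_law; apply: eq_bigr => m _; congr (_ * _).
rewrite -(sum_prod_marginal (f := fun u => bern (lam u))); last first.
  by move=> i; exact: sum_bern.
apply: eq_bigr => a _; congr (_ * _).
rewrite -sum_serve.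
exact: (sum_prod_marginal (f := fun u (r : {ffun 'I_K -> bool}) =>
  \prod_(k < K) bern (mu u k) (r k)) sum_services1 u
  (fun r => phi m (a u) (serve (val m u) r))).
Qed.

Hypothesis pol_ok : valid_policy pol.
Hypothesis lam01 : forall u, 0 <= lam u <= 1.
Hypothesis mu01 : forall u k, 0 <= mu u k <= 1.

Lemma step_law_server h u k (phi : bool -> bool -> R) :
  \sum_x step_law h x * phi (x.2.1 u) (x.2.2 u k)
  = \sum_a bern (lam u) a * \sum_b bern (mu u k) b * phi a b.
Proof.
rewrite sum_step_law -[RHS]mul1r -[X in _ = X * _](pol_ok.2 h) big_distrl /=.
apply: eq_bigr => m _; congr (_ * _).
rewrite -(sum_prod_marginal (f := fun u => bern (lam u))); last first.
  by move=> i; exact: sum_bern.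
apply: eq_bigr => a _; congr (_ * _).
apply: etrans (sum_prod_marginal (f := fun u (r : {ffun 'I_K -> bool}) =>
  \prod_(k < K) bern (mu u k) (r k)) sum_services1 u
  (fun r => phi (a u) (r k))) _.
by rewrite (sum_prod_marginal (f := fun k => bern (mu u k))) // => i;
  exact: sum_bern.
Qed.

Lemma rate01 m u : 0 <= rate m u <= 1.
Proof. by rewrite /rate; case: (val m u) => [k|]; rewrite ?mu01 ?lexx ?ler01. Qed.

Lemma step_law_ge0 h x : 0 <= step_law h x.
Proof.
rewrite /step_law !mulr_ge0 ?(pol_ok.1) // prodr_ge0 // => u _.
  by rewrite bern_ge0.
by apply: prodr_ge0 => k _; rewrite bern_ge0.
Qed.

Lemma obs_law_ge0 h o : 0 <= obs_law h o.
Proof.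
rewrite /obs_law !mulr_ge0 ?(pol_ok.1) // prodr_ge0 // => u _.
  by rewrite bern_ge0.
by rewrite bern_ge0 ?rate01.
Qed.

Lemma obs_law_sum1 h : \sum_o obs_law h o = 1.
Proof.
under eq_bigr do rewrite -[obs_law _ _]mulr1.
rewrite (sum_obs_law h (fun=> 1)) /=.
under eq_bigr => m _.
  under eq_bigr => a _.
    rewrite -mulr_suml.
    rewrite (sum_prod1 (f := fun u => bern (rate m u))) ?mulr1 ?mul1r; last first.
      by move=> i; exact: sum_bern.
    over.
  rewrite (sum_prod1 (f := fun u => bern (lam u))) ?mulr1; last first.
    by move=> i; exact: sum_bern.
  over.
exact: pol_ok.2.
Qed.

Lemma step_law_sum1 h : \sum_x step_law h x = 1.
Proof.
under eq_bigr do rewrite -[step_law _ _]mulr1.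
rewrite (step_law_observe h (fun=> 1)).
by under eq_bigr do rewrite mulr1; exact: obs_law_sum1.
Qed.

End Kernels.

(** * The one-slot operator of a single queue *)

Section QueueOperator.
Variable R : realType.
Implicit Types (la s : R) (f : nat -> R).

Definition queue_op la s f (q : nat) : R :=
  \sum_a bern la a * \sum_b bern s b * f (q + a - b)%N.

Lemma queue_opE la s f q : queue_op la s f q =
  la * (s * f q + (1 - s) * f q.+1) + (1 - la) * (s * f q.-1 + (1 - s) * f q).
Proof.
by rewrite /queue_op !big_bool /= !addn0 !subn0 addn1 !subn1.
Qed.

Lemma queue_op_nondecreasing la s f : 0 <= la <= 1 -> 0 <= s <= 1 ->
  {homo f : i j / (i <= j)%N >-> i <= j} ->
  {homo queue_op la s f : i j / (i <= j)%N >-> i <= j}.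
Proof.
move=> la01 s01 fh i j ij; apply: ler_sum => a _.
apply: ler_wpM2l; first exact: bern_ge0.
apply: ler_sum => b _; apply: ler_wpM2l; first exact: bern_ge0.
by apply: fh; rewrite leq_sub2r // leq_add2r.
Qed.

Lemma queue_op_rate la s s' f q : 0 <= la <= 1 -> s <= s' ->
  {homo f : i j / (i <= j)%N >-> i <= j} ->
  queue_op la s' f q <= queue_op la s f q.
Proof.
move=> la01 ss' fh; apply: ler_sum => a _.
apply: ler_wpM2l; first exact: bern_ge0.
rewrite !big_bool /= subn0.
have : f (q + a - 1)%N <= f (q + a)%N by apply: fh; rewrite leq_subr.
move: (f (q + a - 1)%N) (f (q + a)%N) => x y xy.
rewrite -subr_ge0 (_ : _ - _ = (s' - s) * (y - x)); last by ring.
by rewrite mulr_ge0 // subr_ge0.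
Qed.

(** A nonempty queue gains the full [s' - s]; an empty one profits from a service only if there is
    an arrival in the same slot, whence the factor [la]. *)
Lemma queue_op_gap la s s' q : 0 <= la <= 1 -> s <= s' ->
  queue_op la s' (fun n => n%:R) q + la * (s' - s)
  <= queue_op la s (fun n => n%:R) q.
Proof.
move=> /andP[la0 la1] ss'; rewrite !queue_opE.
case: q => [|q] /=; first by lra.
rewrite -!natr1.
have : 0 <= (1 - la) * (s' - s) by rewrite mulr_ge0 // subr_ge0.
by nra.
Qed.

End QueueOperator.

(** * Comparison of the policy's queue with the genie queue *)

Section QueueRegret.
Variables (U K : nat) (R : realType).
Variables (pol : policy U K R) (lam : 'I_U -> R) (mu : 'I_U -> 'I_K -> R).
Variables (kstar : 'I_U -> 'I_K) (u : 'I_U).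
Hypothesis pol_ok : valid_policy pol.
Hypothesis inst_ok : instance_ok lam mu kstar.

Local Notation mustar := (mu u (kstar u)).

Definition missed (m : matching U K) : R := (val m u != Some (kstar u))%:R.

Let lam01 : forall v, 0 <= lam v <= 1 := inst_ok.1.
Let mu01 : forall v k, 0 <= mu v k <= 1 := inst_ok.2.1.
Let G := queue_op (lam u) mustar.

(** The genie queue is the same Markov chain whatever the policy does, so its expectations are
    iterates of one operator. *)
Lemma step_expect_Qstar t h f q :
  step_expect pol lam mu t h (fun w => f (Qstar kstar u q w)) = iter t G f q.
Proof.
rewrite /step_expect; elim: t h q => [//|t IH] h q /=.
under eq_bigr do rewrite IH.
exact: (step_law_server _ _ pol_ok h u (kstar u)
  (fun a b => iter t G f (q + a - b)%N)).
Qed.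

Lemma Qstar_le q (w : seq (step U K)) :
  (Qstar kstar u q w <= q + size w)%N.
Proof.
elim: w q => [|x w IH] q /=; first by rewrite addn0.
apply: leq_trans (IH _) _; rewrite addnS -addSn leq_add2r.
by case: (x.2.1 u); lia.
Qed.

Lemma Exp_Qstar_le q t :
  Exp pol lam mu t (fun w => (Qstar kstar u q w)%:R) <= q%:R + t%:R.
Proof.
rewrite ExpE -[leRHS](expect_cst (fun h x => rcons h (observe x))
  (step_law_sum1 lam mu pol_ok) t [::]).
apply: le_expect => [h x|w sw]; first exact: step_law_ge0.
by rewrite -natrD ler_nat -sw Qstar_le.
Qed.

Variable d : R.
Hypothesis d_ge0 : 0 <= d.
Hypothesis gap : forall m, d * missed m <= mustar - rate mu m u.

Let rate_le m : rate mu m u <= mustar.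
Proof.
rewrite -subr_ge0; apply: le_trans (gap m).
by rewrite mulr_ge0 // ler0n.
Qed.

Let G_id_nondecreasing t :
  {homo iter t G (fun n => n%:R) : i j / (i <= j)%N >-> i <= j}.
Proof.
elim: t => [i j|t IH] /=; first by rewrite ler_nat.
exact: queue_op_nondecreasing.
Qed.

(* Replacing the policy's server by the best one lowers the expectation of
   every nondecreasing function of the queue, so the pathwise coupling of the
   two queues is not needed; the last slot gives the strict gain. *)
Lemma Qlen_ge_Qstar_last t h q :
  iter t.+1 G (fun n => n%:R) q
  <= step_expect pol lam mu t.+1 h (fun w => (Qlen u q w)%:R
       - lam u * d * last_val (fun x : step U K => missed x.1) w).
Proof.
rewrite /step_expect; elim: t h q => [|t IH] h q.
  rewrite [leRHS]/= [leRHS](step_law_queue pol lam mu h u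
    (fun m a b => (q + a - b)%:R - lam u * d * missed m)) /=.
  rewrite -[leLHS]mul1r -[X in X * _ <= _](pol_ok.2 h) mulr_suml.
  apply: ler_sum => m _; apply: ler_wpM2l; first exact: pol_ok.1.
  have /= := queue_op_gap q (lam01 u) (rate_le m).
  have : lam u * (d * missed m) <= lam u * (mustar - rate mu m u).
    by apply: ler_wpM2l => //; case/andP: (lam01 u).
  rewrite /G !queue_opE !big_bool /= !addn0 !subn0 addn1 !subn1 /=.
  by lra.
have -> : iter t.+2 G (fun n => n%:R) q = G (iter t.+1 G (fun n => n%:R)) q by [].
pose f := iter t.+1 G (fun n => n%:R).
apply: (@le_trans _ _ (\sum_x step_law pol lam mu h x
    * f (q + x.2.1 u - served x.1 x.2.2 u)%N)).
  rewrite (step_law_queue pol lam mu h u (fun m a b => f (q + a - b)%N)).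
  rewrite -[leLHS]mul1r -[X in X * _ <= _](pol_ok.2 h) mulr_suml.
  apply: ler_sum => m _; apply: ler_wpM2l; first exact: pol_ok.1.
  exact: queue_op_rate (lam01 u) (rate_le m) (@G_id_nondecreasing t.+1).
rewrite [leRHS]expectS; apply: ler_sum => x _.
apply: ler_wpM2l; first exact: step_law_ge0.
apply: le_trans (IH (rcons h (observe x)) _) _.
(* The remaining trajectory is nonempty, so prepending [x] leaves its last value unchanged. *)
rewrite le_eqVlt; apply/orP; left; apply/eqP.
by apply: eq_expect => -[//|y w] _.
Qed.

Lemma Exp_Qlen_ge q t :
  Exp pol lam mu t.+1 (fun w => (Qstar kstar u q w)%:R)
  + lam u * d * step_expect pol lam mu t.+1 [::]
      (last_val (fun x : step U K => missed x.1))
  <= Exp pol lam mu t.+1 (fun w => (Qlen u q w)%:R).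
Proof.
rewrite !ExpE (step_expect_Qstar _ _ (fun n => n%:R)) -lerBrDr.
apply: le_trans (Qlen_ge_Qstar_last t [::] q) _.
rewrite /step_expect -mulNr -expectZ -expectD le_eqVlt; apply/orP; left.
by apply/eqP/eq_expect => w _; rewrite mulNr.
Qed.

End QueueRegret.

(** * Finite mean of the stationary genie queue *)

Section StationaryQueue.
Variables (R : realType) (la s : R) (pi : nat -> R).
Hypothesis pi_stat : stationary la s pi.

Lemma eseries_finite_support (f : nat -> R) n :
  (forall i, 0 <= f i) -> (forall i, (n <= i)%N -> f i = 0) ->
  (\sum_(i <oo) (f i)%:E = (\sum_(0 <= i < n) f i)%:E)%E.
Proof.
move=> f0 fn; rewrite (nneseries_split 0 n) => [|k _]; last by rewrite lee_fin.
rewrite add0n eseries0 ?adde0 ?sumEFin // => i ni _.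
by rewrite fn.
Qed.

Hypothesis la0 : 0 <= la.
Hypothesis la_s : la < s.
Hypothesis s1 : s <= 1.

Lemma qkernel_ge0 i j : 0 <= qkernel la s i j.
Proof.
have s0 := le_lt_trans la0 la_s; have la1 := lt_le_trans la_s s1.
apply: sumr_ge0 => a _; apply: sumr_ge0 => b _.
by rewrite !mulr_ge0 ?bern_ge0 ?ler0n ?la0 ?s1 ?ltW.
Qed.

Lemma qkernel_far i j : (i.+1 < j)%N || (j.+1 < i)%N -> qkernel la s i j = 0.
Proof.
move=> ij; rewrite /qkernel big1 // => a _; rewrite big1 // => b _.
rewrite (_ : (_ == j) = false) ?mulr0 //.
by apply/eqP; case: a; case: b; lia.
Qed.

Lemma qkernel_up i : qkernel la s i i.+1 = la * (1 - s).
Proof.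
rewrite /qkernel !big_bool /= addn1 addn0 !subn0 !subn1 eqxx /=.
have -> : (i == i.+1) = false by apply/eqP; lia.
have -> : (i.-1 == i.+1) = false by apply/eqP; lia.
by rewrite !mulr0 !mulr1; ring.
Qed.

Lemma qkernel_down i : qkernel la s i.+1 i = s * (1 - la).
Proof.
rewrite /qkernel !big_bool /= addn1 addn0 !subn0 !subn1 eqxx /=.
have -> : (i.+1 == i) = false by apply/eqP; lia.
have -> : (i.+2 == i) = false by apply/eqP; lia.
by rewrite !mulr0 !mulr1; ring.
Qed.

Lemma qkernel00 : qkernel la s 0 0 = 1 - la * (1 - s).
Proof. by rewrite /qkernel !big_bool /=; ring. Qed.

Lemma qkernel_stay i :
  qkernel la s i.+1 i.+1 = 1 - la * (1 - s) - s * (1 - la).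
Proof.
rewrite /qkernel !big_bool /= addn1 addn0 !subn0 !subn1 eqxx /=.
have -> : (i.+2 == i.+1) = false by apply/eqP; lia.
have -> : (i == i.+1) = false by apply/eqP; lia.
by rewrite !mulr0 !mulr1; ring.
Qed.

Lemma stationary_balance j :
  pi j = \sum_(0 <= i < j.+2) pi i * qkernel la s i j.
Proof.
have [pi0 [_ pij]] := pi_stat.
apply: EFin_inj; rewrite pij; apply: eseries_finite_support => [i|i ji].
  by rewrite mulr_ge0 // qkernel_ge0.
by rewrite qkernel_far ?mulr0 //; apply/orP; right.
Qed.

(** The queue length is a birth-death chain, so by induction global balance reduces to equal flows
    across each edge. *)
Lemma stationary_detailed_balance j :
  pi j.+1 * (s * (1 - la)) = pi j * (la * (1 - s)).
Proof.
elim: j => [|j IH].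
  have := stationary_balance 0.
  rewrite !big_nat_recr //= big_geq // qkernel00 qkernel_down; lra.
have := stationary_balance j.+1.
rewrite 3?big_nat_recr //= qkernel_stay qkernel_down qkernel_up.
(* Only [j], [j.+1] and [j.+2] can lead to [j.+1] in one slot; the other terms vanish. *)
rewrite big_nat_cond big1 => [|i /andP[/andP[_ ij] _]]; last first.
  by rewrite qkernel_far ?mulr0 // ltnS ij.
by move: IH; lra.
Qed.

(** Multiplying detailed balance by [q.+1] and summing gives a recursion for the truncated means.
    Its two coefficients differ by [s - la], so stability bounds the means uniformly in [n]. *)
Lemma stationary_partial_mean n :
  (\sum_(0 <= q < n) pi q * q%:R) * (s - la) <= la * (1 - s).
Proof.
have [pi0 [pi1 _]] := pi_stat.
have s0 := le_lt_trans la0 la_s; have la1 := lt_le_trans la_s s1.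
pose M n := \sum_(0 <= q < n) pi q * q%:R.
have Mrec k : M k.+1 = M k + pi k * k%:R by rewrite /M big_nat_recr.
have P_le1 k : \sum_(0 <= q < k) pi q <= 1.
  rewrite -lee_fin -sumEFin -pi1; apply: nneseries_lim_ge => i _ _.
  by rewrite lee_fin.
have MS k : M k.+1 * (s * (1 - la))
    = (M k + \sum_(0 <= q < k) pi q) * (la * (1 - s)).
  elim: k => [|k IH].
    by rewrite /M big_nat1 big_geq // big_geq // !mulr0 !mul0r addr0 mul0r.
  rewrite Mrec mulrDl IH Mrec [\sum_(0 <= q < k.+1) pi q]big_nat_recr //=.
  rewrite -[k.+1%:R]natr1 [pi k.+1 * _]mulrC -mulrA.
  by rewrite stationary_detailed_balance; ring.
case: n => [|n]; first by rewrite big_geq // mul0r mulr_ge0 // subr_ge0.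
rewrite -/(M n.+1).
have Mn : M n <= M n.+1.
  by rewrite Mrec lerDl mulr_ge0.
have b0 : 0 <= la * (1 - s) by rewrite mulr_ge0 // subr_ge0.
have : (M n + \sum_(0 <= q < n) pi q) * (la * (1 - s))
    <= (M n.+1 + 1) * (la * (1 - s)) by rewrite ler_wpM2r // lerD.
by rewrite -MS; lra.
Qed.

Lemma stationary_mean_lty (B : nat -> R) (c : R) :
  (forall q, 0 <= B q <= q%:R + c) ->
  (\sum_(q <oo) (pi q * B q)%:E < +oo)%E.
Proof.
have [pi0 [pi1 _]] := pi_stat => B0.
have c0 : 0 <= c by have := B0 0; rewrite add0r => /andP[/le_trans h /h].
have P_le1 k : \sum_(0 <= q < k) pi q <= 1.
  rewrite -lee_fin -sumEFin -pi1; apply: nneseries_lim_ge => i _ _.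
  by rewrite lee_fin.
apply: (@le_lt_trans _ _ ((la * (1 - s) / (s - la) + c)%:E)); last first.
  exact: ltry.
apply: lime_le.
  apply: is_cvg_nneseries => q _ _; rewrite lee_fin mulr_ge0 //.
  by case/andP: (B0 q).
apply: nearW => n; rewrite sumEFin lee_fin.
apply: (@le_trans _ _ (\sum_(0 <= q < n) (pi q * q%:R + pi q * c))).
  apply: ler_sum => q _; rewrite -mulrDr; apply: ler_wpM2l => //.
  by case/andP: (B0 q).
rewrite big_split /= -mulr_suml; apply: lerD; last by rewrite ler_piMl.
by rewrite ler_pdivlMr ?subr_gt0 // stationary_partial_mean.
Qed.

(** Finiteness of the subtracted series allows it to be moved across the inequality in the extended
    reals; [g] is written as its own average under [pi]. *)
Lemma stationary_sub_ge (A B : nat -> R) (g c : R) : 0 <= g ->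
  (forall q, 0 <= B q <= q%:R + c) -> (forall q, B q + g <= A q) ->
  (g%:E <= \sum_(q <oo) (pi q * A q)%:E - \sum_(q <oo) (pi q * B q)%:E)%E.
Proof.
move=> g0 B0 AB; have [pi0 [pi1 _]] := pi_stat.
have Bfin : (\sum_(q <oo) (pi q * B q)%:E \is a fin_num)%E.
  rewrite ge0_fin_numE ?(stationary_mean_lty B0) //.
  apply: nneseries_ge0 => q _ _; rewrite lee_fin mulr_ge0 //.
  by case/andP: (B0 q).
rewrite leeBrDr //.
have -> : g%:E = (\sum_(q <oo) (g%:E * (pi q)%:E))%E.
  by rewrite nneseriesZl ?pi1 ?mule1 // => q _; rewrite lee_fin.
rewrite -nneseriesD.
- apply: lee_nneseries => [q _ _|q _].
    rewrite -EFinM -EFinD lee_fin addr_ge0 ?mulr_ge0 //.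
    by case/andP: (B0 q).
  rewrite -EFinM -EFinD lee_fin (mulrC g) -mulrDr; apply: ler_wpM2l => //.
  by rewrite addrC.
- by move=> q _ _; rewrite -EFinM lee_fin mulr_ge0.
- by move=> q _ _; rewrite lee_fin mulr_ge0 //; case/andP: (B0 q).
Qed.

End StationaryQueue.

(** * Regret bounded below by the probability of missing the best server *)

Section PsiLowerBound.
Variables (U K : nat) (R : realType).
Variables (pol : policy U K R) (lam : 'I_U -> R) (mu : 'I_U -> 'I_K -> R).
Variables (kstar : 'I_U -> 'I_K) (pi : 'I_U -> nat -> R).

Definition miss_prob u t : R := obs_expect pol lam mu t [::]
  (last_val (fun o : obs U K => missed R kstar u o.1)).

Hypothesis pol_ok : valid_policy pol.
Hypothesis inst_ok : instance_ok lam mu kstar.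
Hypothesis pi_stat : forall u, stationary (lam u) (mu u (kstar u)) (pi u).

Lemma miss_prob_ge0 u t : 0 <= miss_prob u t.
Proof.
apply: expect_ge0 => [h o|w]; first by
  apply: obs_law_ge0; [| exact: inst_ok.1 | exact: inst_ok.2.1].
rewrite /last_val; case: (lastP w) => [//|w' o].
by rewrite map_rcons last_rcons ler0n.
Qed.

(** [d] stays free: the minimal gap yields the rate, and [d = 0] yields nonnegative regret. *)
Lemma Psi_ge u d t : 0 <= d ->
  (forall m, d * missed R kstar u m <= mu u (kstar u) - rate mu m u) ->
  ((lam u * d * miss_prob u t.+1)%:E <= Psi pol lam mu kstar pi u t.+1)%E.
Proof.
move=> d0 gap; have [lam01 [mu01 [_ [_ stab]]]] := inst_ok.
have /andP[la0 la1] := lam01 u.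
have /andP[_ s1] := mu01 u (kstar u).
apply: (stationary_sub_ge (pi_stat u) la0 (stab u) s1 (c := t.+1%:R)).
- by rewrite mulr_ge0 ?mulr_ge0 // miss_prob_ge0.
- move=> q; rewrite Exp_Qstar_le // andbT ExpE.
  by apply: expect_ge0 => [h x|w]; [exact: step_law_ge0 | exact: ler0n].
- move=> q; have := Exp_Qlen_ge pol_ok inst_ok d0 gap q t.
  congr (_ + _ * _ <= _).
  rewrite /miss_prob -step_expect_observe; apply: eq_expect => w _.
  by rewrite /last_val -map_comp.
Qed.

End PsiLowerBound.

(** * Divergence between Bernoulli laws *)

Section BernoulliDivergence.
Variable R : realType.
Implicit Types p q : R.

Definition kl_bern p q : R :=
  p * ln (p / q) + (1 - p) * ln ((1 - p) / (1 - q)).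

Lemma sum_bern_llr p q :
  \sum_b bern p b * ln (bern p b / bern q b) = kl_bern p q.
Proof. by rewrite big_bool. Qed.

(** This is the tangent-line bound for the logarithm; added over the two outcomes it makes the
    divergence nonnegative. *)
Lemma mul_ln_ge p q : 0 <= p -> 0 < q -> p - q <= p * ln (p / q).
Proof.
move=> p0 q0; have [->|pn0] := eqVneq p 0.
  by rewrite mul0r sub0r oppr_le0 ltW.
have {pn0} pp : 0 < p by rewrite lt_def pn0.
have : ln (1 + (q / p - 1)) <= q / p - 1.
  by apply: le_ln1Dx; rewrite ltrBrDr addNr divr_gt0.
rewrite addrC subrK -[q / p]invf_div lnV ?posrE ?divr_gt0 //.
rewrite invf_div => h.
have := ler_wpM2l p0 h; rewrite mulrBr mulr1 mulrCA divff ?gt_eqF // mulr1.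
by lra.
Qed.

Lemma kl_bern_ge0 p q : 0 <= p <= 1 -> 0 < q < 1 -> 0 <= kl_bern p q.
Proof.
move=> /andP[p0 p1] /andP[q0 q1].
have := mul_ln_ge p0 q0; have : 0 <= 1 - p by lra.
move=> /mul_ln_ge h; have /h : 0 < 1 - q by lra.
by rewrite /kl_bern; lra.
Qed.

(** This makes the divergence from [mu_min] a common bound on the cost of raising any pair to
    [q]. *)
Lemma kl_bern_anti p p' q : 0 <= p -> p <= p' -> p' < q -> q < 1 ->
  kl_bern p' q <= kl_bern p q.
Proof.
move=> p0 pp' p'q q1; have [p'0|p'n0] := eqVneq p' 0.
  by have -> : p = p' by apply/eqP; rewrite eq_le pp' p'0 p0.
have p'_gt0 : 0 < p' by rewrite lt_def p'n0 (le_trans p0).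
have q0 : 0 < q by lra.
(* [kl p q = kl p p' + kl p' q + (p' - p) * (log-odds of q - log-odds of p')]. *)
have split (x y z : R) : 0 <= x -> 0 < y -> 0 < z ->
    x * ln (x / z) = x * ln (x / y) + x * (ln y - ln z).
  move=> x0 y0 z0; have [->|xn0] := eqVneq x 0; first by rewrite !mul0r addr0.
  have xp : 0 < x by rewrite lt_def xn0.
  by rewrite !ln_div ?posrE //; ring.
have p'01 : 0 < p' < 1 by lra.
have p01 : 0 <= p <= 1 by lra.
have := kl_bern_ge0 p01 p'01; rewrite /kl_bern.
have p'1 : 0 < 1 - p' by lra.
have q1' : 0 < 1 - q by lra.
rewrite (split p p' q) // (split (1 - p) (1 - p') (1 - q)) //; last by lra.
rewrite [ln (p' / q)]ln_div ?posrE // [ln ((1 - p') / _)]ln_div ?posrE //.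
have : ln p' <= ln q by rewrite ler_ln ?posrE // ltW.
have : ln (1 - q) <= ln (1 - p') by rewrite ler_ln ?posrE //; lra.
move: (ln p') (ln q) (ln (1 - p')) (ln (1 - q)) => a b c d dc ab.
move: (p * ln (p / p')) ((1 - p) * ln ((1 - p) / (1 - p'))) => x y.
have : 0 <= (p' - p) * (b - a) by rewrite mulr_ge0; lra.
have : 0 <= (p' - p) * (c - d) by rewrite mulr_ge0; lra.
by lra.
Qed.

(** Equality holds unless [b] has mass 0 under [p], where the left side vanishes. *)
Lemma bern_mul_expR_llr p q b : 0 <= p <= 1 -> 0 < q < 1 ->
  bern p b * expR (- ln (bern p b / bern q b)) <= bern q b.
Proof.
move=> p01 /andP[q0 q1].
have qb : 0 < bern q b by case: b => //=; rewrite subr_gt0.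
have [->|pn0] := eqVneq (bern p b) 0; first by rewrite mul0r ltW.
have pb : 0 < bern p b by rewrite lt_def pn0 bern_ge0.
rewrite expRN lnK ?posrE ?divr_gt0 // invf_div mulrCA divff ?mulr1 //.
Qed.

End BernoulliDivergence.

(** * Distinguishing an instance from a perturbed one *)

Section Perturbation.
Variables (U K : nat) (R : realType).
Variables (pol : policy U K R) (lam : 'I_U -> R) (mu : 'I_U -> 'I_K -> R).
Variables (kstar : 'I_U -> 'I_K) (q kl alpha : R).
Hypothesis pol_ok : valid_policy pol.
Hypothesis inst_ok : instance_ok lam mu kstar.
Hypothesis q_lt1 : q < 1.
Hypothesis mu_lt_q : forall u k, mu u k < q.
Hypothesis kl_ge : forall u k, kl_bern (mu u k) q <= kl.
Hypothesis alpha_lt1 : alpha < 1.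

Let lam01 : forall v, 0 <= lam v <= 1 := inst_ok.1.
Let mu01 : forall v k, 0 <= mu v k <= 1 := inst_ok.2.1.
Let q01 (u : 'I_U) (k : 'I_K) : 0 < q < 1.
Proof.
by rewrite q_lt1 andbT; apply: le_lt_trans (mu_lt_q u k); case/andP: (mu01 u k).
Qed.

Definition hit (u : 'I_U) (k : 'I_K) (o : obs U K) : R :=
  (val o.1 u == Some k)%:R.
Definition miss (u : 'I_U) (o : obs U K) : R := missed R kstar u o.1.

Lemma Tcount_cumul u k (w : seq (step U K)) :
  (Tcount u k w)%:R = cumul (hit u k) (map (@observe U K) w).
Proof.
elim: w => [|x w IH]; first by rewrite /cumul big_nil.
by rewrite /= cumul_cons -IH -natrD.
Qed.

Lemma Exp_Tcount mu' u k t :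
  Exp pol lam mu' t (fun w => (Tcount u k w)%:R)
  = obs_expect pol lam mu' t [::] (cumul (hit u k)).
Proof.
rewrite ExpE -step_expect_observe; apply: eq_expect => w _.
exact: Tcount_cumul.
Qed.

Variable g : 'I_U -> 'I_K.
Hypothesis g_inj : injective g.

(* The alternative instance has [g] as its optimal matching: a server is
   improved to [q] exactly where [g] departs from [kstar]. *)
Definition raised v j := (g v != kstar v) && (j == g v).

Definition perturbed (v : 'I_U) (j : 'I_K) : R :=
  if raised v j then q else mu v j.

(** [q] exceeds every rate of [mu], so a raised server is the unique best one of its queue and
    stability persists; the other rows are unchanged. *)
Lemma perturbed_ok : instance_ok lam perturbed g.
Proof.
have [_ [_ [opt [_ stab]]]] := inst_ok; rewrite /perturbed /raised.
split; first exact: lam01.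
split; first by move=> v j; case: ifP => // _;
  have /andP[/ltW q0 _] := q01 v j; rewrite q0 ltW.
split.
  move=> v j jg; rewrite (negbTE jg) andbF eqxx andbT.
  have [gv|_] /= := eqVneq (g v) (kstar v) => //.
  by rewrite gv; apply: opt; rewrite -gv.
split=> // v; rewrite eqxx andbT.
have [gv|_] /= := eqVneq (g v) (kstar v); first by rewrite gv.
exact: lt_trans (stab v) (mu_lt_q _ _).
Qed.

(** Log-likelihood ratio of the observed services between the two instances; a pair that is not
    raised has the same law in both. *)
Definition obs_llr (o : obs U K) : R :=
  \sum_v (if val o.1 v is Some k then
    if raised v k then ln (bern (mu v k) (o.2.2 v) / bern q (o.2.2 v)) else 0
    else 0).

Definition raised_hits (o : obs U K) : R :=
  \sum_(v | g v != kstar v) hit v (g v) o.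

Lemma obs_law_perturbed h o :
  obs_law pol lam mu h o * expR (- obs_llr o) <= obs_law pol lam perturbed h o.
Proof.
rewrite /obs_law -mulrA; apply: ler_wpM2l.
  by rewrite mulr_ge0 ?pol_ok.1 // prodr_ge0 // => v _; rewrite bern_ge0.
rewrite /obs_llr -sumrN expR_sum -big_split /=; apply: ler_prod => v _.
rewrite mulr_ge0 ?expR_ge0 ?bern_ge0 ?rate01 //= /rate /perturbed.
case: (val o.1 v) => [k|]; last by rewrite oppr0 expR0 mulr1.
case: ifP => _; first by rewrite bern_mul_expR_llr // (q01 v k).
by rewrite oppr0 expR0 mulr1.
Qed.

(** Given the matching, each raised pair in use contributes in mean its divergence to [q], hence at
    most [kl]. *)
Lemma sum_obs_llr h : \sum_o obs_law pol lam mu h o * obs_llr o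
  <= \sum_o obs_law pol lam mu h o * (kl * raised_hits o).
Proof.
rewrite !sum_obs_law; apply: ler_sum => m _; apply: ler_wpM2l.
  exact: pol_ok.1.
apply: ler_sum => a _; apply: ler_wpM2l.
  by rewrite prodr_ge0 // => v _; rewrite bern_ge0.
pose H : R := \sum_(v | g v != kstar v) (val m v == Some (g v))%:R.
have -> : \sum_(s : {ffun 'I_U -> bool}) (\prod_(v < U) bern (rate mu m v) (s v))
    * (kl * raised_hits (m, (a, s))) = kl * H.
  rewrite -[RHS]mul1r -[X in _ = X * _](sum_prod1
    (f := fun v => bern (rate mu m v))) ?mulr_suml // => v.
  exact: sum_bern.
rewrite /obs_llr /H big_distrr /= [leRHS]big_mkcond /=.
under eq_bigr do rewrite big_distrr /=.
rewrite exchange_big /=; apply: ler_sum => v _.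
rewrite (sum_prod_marginal (f := fun v => bern (rate mu m v)) _ v
  (fun b => if val m v is Some k then
    if raised v k then ln (bern (mu v k) b / bern q b) else 0 else 0));
  last by move=> i; exact: sum_bern.
rewrite /rate /raised; case: (val m v) => [k|]; last first.
  by under eq_bigr do rewrite mulr0; rewrite big1 // mulr0; case: ifP.
rewrite (inj_eq (@Some_inj _)); case: ifP => _ /=; last first.
  by under eq_bigr do rewrite mulr0; rewrite big1.
case: eqP => _; last by under eq_bigr do rewrite mulr0; rewrite big1 // mulr0.
by rewrite sum_bern_llr mulr1.
Qed.

(** The event [B] is likely under [mu], as misses are few, and unlikely in the perturbed instance by
    consistency. The change of measure with exponent [c * B - ln Z] turns this contrast into a lower
    bound on the mean log-likelihood ratio. *)
Lemma perturbed_growth u t C : (0 < t)%N -> 0 <= C ->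
  obs_expect pol lam perturbed t [::] (cumul (hit u (kstar u)))
    <= C * t%:R `^ alpha ->
  obs_expect pol lam mu t [::] (cumul (miss u)) <= t%:R / 8 ->
  3 / 4 * ((1 - alpha) * ln t%:R) - ln (1 + 2 * C)
    <= kl * obs_expect pol lam mu t [::] (cumul raised_hits).
Proof.
move=> t0 C0 EC En; have [_ [pert01 _]] := perturbed_ok.
have tR : 0 < t%:R :> R by rewrite ltr0n.
pose Z := 1 + 2 * C; have Z0 : 0 < Z by rewrite /Z; lra.
pose c := (1 - alpha) * ln (t%:R : R).
have c0 : 0 <= c.
  by rewrite mulr_ge0 ?subr_ge0 ?(ltW alpha_lt1) // ln_ge0 // ler1n.
(* Consistency does not bound the slots in which a queue is left unassigned, so
   the test event concerns the former best server of [u], which is suboptimal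
   in the perturbed instance. *)
pose B (w : seq (obs U K)) : R :=
  (t%:R <= 2 * cumul (hit u (kstar u)) w)%R%:R.
pose p := obs_law pol lam mu; pose p' := obs_law pol lam perturbed.
have p0 : forall h x, 0 <= p h x by move=> h x; exact: obs_law_ge0.
have p'0 : forall h x, 0 <= p' h x by move=> h x; exact: obs_law_ge0.
have p1 : forall h, \sum_x p h x = 1 by exact: obs_law_sum1.
have p'1 : forall h, \sum_x p' h x = 1 by exact: obs_law_sum1.
have hit0 w : 0 <= cumul (hit u (kstar u)) w.
  by apply: sumr_ge0 => o _; exact: ler0n.
have := expect_change_measure rcons p0 p'0 obs_law_perturbed t [::]
  (fun w => c * B w - ln Z).
(* By Markov, [expR (c * B)] has mean at most [1 + expR c * (2 / t) * (C * t ^ alpha)], which is [Z]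
   because [expR c] is [t] to the power [1 - alpha]. *)
have le1 : expect rcons p' t [::] (fun w => expR (c * B w - ln Z)) <= 1.
  have bnd w : expR (c * B w - ln Z) <= Z^-1 + Z^-1
      * (expR c * (2 / t%:R)) * cumul (hit u (kstar u)) w.
    rewrite expRD expRN lnK ?posrE // mulrC -mulrA -{2}[Z^-1]mulr1 -mulrDr.
    apply: ler_wpM2l; first by rewrite invr_ge0 ltW.
    rewrite /B; case: (leP t%:R (2 * cumul _ w)) => hB; last first.
      by rewrite mulr0 expR0 lerDl mulr_ge0 // mulr_ge0 ?expR_ge0 ?divr_ge0.
    rewrite mulr1 -mulrA; apply: (@le_trans _ _ (expR c * 1)).
      by rewrite mulr1.
    apply: (@le_trans _ _
      (expR c * (2 / t%:R * cumul (hit u (kstar u)) w))).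
      apply: ler_wpM2l; first exact: expR_ge0.
      by rewrite mulrAC ler_pdivlMr // mul1r.
    by rewrite lerDr.
  apply: le_trans (le_expect rcons p'0 [::] (fun w _ => bnd w)) _.
  rewrite expectD expectZ expect_cst //.
  have : Z^-1 * (expR c * (2 / t%:R))
      * expect rcons p' t [::] (cumul (hit u (kstar u)))
      <= Z^-1 * (expR c * (2 / t%:R)) * (C * t%:R `^ alpha).
    apply: ler_wpM2l => //.
    by rewrite !mulr_ge0 ?invr_ge0 ?expR_ge0 // ltW.
  have -> : Z^-1 * (expR c * (2 / t%:R)) * (C * t%:R `^ alpha)
      = Z^-1 * (2 * C).
    have tal : expR c * t%:R `^ alpha = t%:R.
      rewrite /powR gt_eqF // -expRD /c -mulrDl subrK mul1r lnK ?posrE //.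
    transitivity (Z^-1 * (2 * C) * (expR c * t%:R `^ alpha / t%:R)).
      by ring.
    by rewrite tal divff ?mulr1 // gt_eqF.
  have : Z^-1 * Z = 1 by rewrite mulVf // gt_eqF.
  by rewrite {2}/Z mulrDr mulr1; lra.
have EL : expect rcons p t [::] (cumul obs_llr)
    <= kl * expect rcons p t [::] (cumul raised_hits).
  apply: le_trans (le_expect_cumul rcons p0 p1 t [::] sum_obs_llr) _.
  rewrite -expectZ le_eqVlt; apply/orP; left; apply/eqP/eq_expect => w _.
  by rewrite /cumul big_distrr.
(* Each slot is a hit or a miss, so [B] fails only with more than [t / 2] misses; their mean is at
   most [t / 8], and Markov gives 1/4. *)
have EB : 3 / 4 <= expect rcons p t [::] B.
  have bnd w : size w = t -> 1 + (- (2 / t%:R)) * cumul (miss u) w <= B w.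
    move=> sw.
    have tot : cumul (hit u (kstar u)) w + cumul (miss u) w = t%:R.
      rewrite /cumul -big_split /= -sw -sum1_size natr_sum.
      apply: eq_bigr => o _; rewrite /hit /miss /missed.
      by case: eqP => _; rewrite ?addr0 ?add0r.
    have m0 : 0 <= cumul (miss u) w.
      by apply: sumr_ge0 => o _; exact: ler0n.
    rewrite /B mulNr mulrAC; case: (leP t%:R (2 * cumul _ w)) => hB.
      by rewrite gerDl oppr_le0 divr_ge0 ?mulr_ge0 // ltW.
    by rewrite subr_le0 ler_pdivlMr // mul1r; lra.
  apply: le_trans (le_expect rcons p0 [::] bnd).
  rewrite expectD expectZ expect_cst //.
  have := ler_wpM2l (_ : 0 <= 2 / t%:R) En.
  rewrite (_ : 2 / t%:R * (t%:R / 8) = 1 / 4); last first.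
    by field; rewrite gt_eqF.
  by rewrite divr_ge0 ?(ltW tR) // => /(_ isT); rewrite /obs_expect -/p; lra.
move=> /le_trans /(_ le1).
rewrite expectD expect_cst // expectD.
under [X in _ + (_ + X) <= _]eq_expect do rewrite -mulN1r.
rewrite expectZ expectD expectZ expect_cst // -/c -/Z /obs_expect -/p.
have := ler_wpM2l c0 EB; move: EL; rewrite /obs_llr; lra.
Qed.

End Perturbation.

(** The events [b i] exclude one another, so at most one term is 1. *)
Lemma sum_excl_le (R : realType) (I : finType) (P : pred I) (b : pred I)
    (c : bool) :
  {in P &, forall i j, b i -> b j -> i = j} ->
  {in P, forall i, b i -> c} ->
  \sum_(i | P i) (b i)%:R <= c%:R :> R.
Proof.
move=> uniq bc; have [/existsP[i /andP[Pi bi]]|/existsPn nb] :=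
  boolP [exists i, P i && b i].
  rewrite (bigD1 i) //= big1 => [|j /andP[Pj ji]].
    by rewrite addr0 bi (bc i).
  have [bj|//] := boolP (b j).
  by rewrite (uniq j i) ?eqxx in ji.
rewrite big1 ?ler0n // => i Pi.
by have := nb i; rewrite Pi /= => /negbTE ->.
Qed.

(** * Logarithmic growth of the number of misses *)

Section MissGrowth.
Variables (U K : nat) (R : realType).
Variables (pol : policy U K R) (lam : 'I_U -> R) (mu : 'I_U -> 'I_K -> R).
Variables (kstar : 'I_U -> 'I_K) (q kl alpha : R).
Hypothesis pol_ok : valid_policy pol.
Hypothesis inst_ok : instance_ok lam mu kstar.
Hypothesis q_lt1 : q < 1.
Hypothesis mu_lt_q : forall u k, mu u k < q.
Hypothesis kl_ge0 : 0 <= kl.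
Hypothesis kl_ge : forall u k, kl_bern (mu u k) q <= kl.
Hypothesis alpha_lt1 : alpha < 1.
Hypothesis pol_cons : consistent alpha pol.

Let lam01 : forall v, 0 <= lam v <= 1 := inst_ok.1.
Let mu01 : forall v k, 0 <= mu v k <= 1 := inst_ok.2.1.
Let kstar_inj : injective kstar := inst_ok.2.2.2.1.

Local Notation E t := (obs_expect pol lam mu t [::]).

Definition misses u t : R := E t (cumul (miss R kstar u)).

Lemma perturbed_growth_eventually u (g : {ffun 'I_U -> 'I_K}) :
  injective g -> g u != kstar u ->
  exists C : R, exists N : nat, forall t, (N <= t)%N -> misses u t <= t%:R / 8 ->
    3 / 4 * ((1 - alpha) * ln t%:R) - C
      <= kl * E t (cumul (raised_hits R kstar g)).
Proof.
move=> g_inj gu.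
have ok := perturbed_ok inst_ok q_lt1 mu_lt_q g_inj.
have ku : kstar u != g u by rewrite eq_sym.
have [C [N CN]] := pol_cons ok ku.
(* The growth bound asks for a nonnegative constant and a positive time, hence the two maxima. *)
exists (ln (1 + 2 * Num.max C 0)), (maxn N 1) => t.
rewrite geq_max => /andP[Nt t0] small.
apply: (perturbed_growth pol_ok inst_ok q_lt1 mu_lt_q kl_ge alpha_lt1 g_inj
  (u := u)) => //.
  by rewrite le_max lexx orbT.
rewrite -Exp_Tcount; apply: le_trans (CN t Nt) _.
by apply: ler_wpM2r; rewrite ?powR_ge0 // le_max lexx.
Qed.

(** Consistency gives constants that depend on the instance; finitely many [g] allow common ones, so
    that the bounds can be summed over [g]. *)
Lemma perturbed_growth_uniform u :
  exists C : R, exists N : nat, forall t, (N <= t)%N -> misses u t <= t%:R / 8 ->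
    forall g : {ffun 'I_U -> 'I_K}, injective g -> g u != kstar u ->
    3 / 4 * ((1 - alpha) * ln t%:R) - C
      <= kl * E t (cumul (raised_hits R kstar g)).
Proof.
have /fin_all_exists[CN CNP] (g : {ffun 'I_U -> 'I_K}) :
    exists CN : R * nat, injective g -> g u != kstar u ->
    forall t, (CN.2 <= t)%N -> misses u t <= t%:R / 8 ->
    3 / 4 * ((1 - alpha) * ln t%:R) - CN.1
      <= kl * E t (cumul (raised_hits R kstar g)).
  have [[g_inj gu]|nok] := pselect (injective g /\ g u != kstar u).
    have [C [N CN]] := perturbed_growth_eventually g_inj gu.
    by exists (C, N).
  by exists (0, 0%N) => gi gu; case: nok.
exists (\sum_g `|(CN g).1|), (\max_g (CN g).2) => t Nt small g g_inj gu.
apply: le_trans (CNP g g_inj gu t _ small).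
  apply: lerB => //; apply: le_trans (ler_norm _) _.
  by rewrite (bigD1 g) //= lerDl sumr_ge0.
by apply: leq_trans Nt; exact: leq_bigmax.
Qed.

Let p0 : forall h o, 0 <= obs_law pol lam mu h o.
Proof. by move=> h o; exact: obs_law_ge0. Qed.

Let E_le t (c c' : obs U K -> R) : (forall o, c o <= c' o) ->
  E t (cumul c) <= E t (cumul c').
Proof.
by move=> cc'; apply: le_expect => // w _; apply: ler_sum => o _.
Qed.

Let E_sum t (I : finType) (P : pred I) (c : I -> obs U K -> R) :
  \sum_(i | P i) E t (cumul (c i)) = E t (cumul (fun o => \sum_(i | P i) c i o)).
Proof.
rewrite -expect_sum; apply: eq_expect => w _.
by rewrite /cumul exchange_big.
Qed.

Let redirect u k : {ffun 'I_U -> 'I_K} :=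
  [ffun v => if v == u then k else kstar v].
(* [kstar u'] cannot become the best server of [u] alone, since it would then
   be the best server of two queues. *)
Let swap u u' : {ffun 'I_U -> 'I_K} := [ffun v => kstar (tperm u u' v)].

(** Queue [u] uses at most one server, and a free server is never [kstar u]. *)
Lemma free_server_hits u o :
  \sum_(k | k \notin codom kstar) raised_hits R kstar (redirect u k) o
  <= miss R kstar u o.
Proof.
under eq_bigr => k kf.
  rewrite /raised_hits (big_pred1 u) /hit ?ffunE ?eqxx => [|v]; last first.
    rewrite /= ffunE; have [->|_] := eqVneq v u; last by rewrite eqxx.
    by apply: contraNneq kf => ->; rewrite codom_f.
  over.
apply: sum_excl_le => [k k' _ _ /eqP-> /eqP[]//|k kf /eqP ->].
by apply: contraNneq kf => -[->]; rewrite codom_f.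
Qed.

Lemma swap_hits u u' o : u' != u ->
  raised_hits R kstar (swap u u') o
  = hit R u (kstar u') o + hit R u' (kstar u) o.
Proof.
move=> uu'; rewrite /raised_hits (bigD1 u) /=; last first.
  by rewrite ffunE tpermL (inj_eq kstar_inj).
rewrite (big_pred1 u') => [|v].
  by rewrite !ffunE tpermL tpermR.
rewrite /= ffunE (inj_eq kstar_inj).
have [->|vu'] := eqVneq v u'; first by rewrite tpermR eq_sym uu'.
have [->|vu] := eqVneq v u; first by rewrite andbF.
by rewrite tpermD ?eqxx // eq_sym.
Qed.

Lemma matching_eq (m : matching U K) u v k :
  val m u = Some k -> val m v = Some k -> u = v.
Proof.
move=> mu_k mv_k; apply/eqP/negPn/negP => uv.
have /forallP/(_ u)/forallP/(_ v) := valP m.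
by rewrite uv /= mu_k mv_k eqxx.
Qed.

(** At most one [u'] has its best server used by [u], and by the matching constraint at most one
    [u'] uses [kstar u]. Either event is a miss of [u], hence the factor 2. *)
Lemma swap_hits_sum u o :
  \sum_(u' | u' != u) raised_hits R kstar (swap u u') o
  <= 2 * miss R kstar u o.
Proof.
under eq_bigr => u' uu' do rewrite swap_hits //.
rewrite big_split /= mulr_natl mulr2n; apply: lerD; apply: sum_excl_le.
- by move=> v v' _ _ /eqP-> /eqP[/kstar_inj].
- move=> v vu /eqP->; rewrite (inj_eq (@Some_inj _)) (inj_eq kstar_inj).
  exact: vu.
- by move=> v v' _ _ /eqP mv /eqP; exact: matching_eq.
- move=> v vu /eqP mv; apply/eqP => mu_k.
  by move: vu; rewrite (matching_eq mv mu_k) unfold_in eqxx.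
Qed.

(** The [U - 1] swaps together cost two per miss, while the [K - U] redirections to free servers
    cost one; keeping the better family gives the maximum. *)
Lemma misses_growth u :
  exists C : R, exists N : nat, forall t, (N <= t)%N -> misses u t <= t%:R / 8 ->
    (maxn (U - 1) (2 * (K - U)))%:R * (3 / 4 * ((1 - alpha) * ln t%:R) - C)
      <= 2 * kl * misses u t.
Proof.
have [C [N CN]] := perturbed_growth_uniform u.
exists C, N => t Nt small; have {CN} := CN t Nt small.
set Y := _ - C => CN.
have [_|_] := leqP (2 * (K - U)) (U - 1).
  have -> : (U - 1)%N = #|[pred u' | u' != u]|.
    by have := cardC1 u; rewrite card_ord subn1 => <-.
  rewrite mulrC mulr_natr -sumr_const.
  apply: (@le_trans _ _ (\sum_(u' | u' != u)
      kl * E t (cumul (raised_hits R kstar (swap u u'))))).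
    apply: ler_sum => u' uu'; apply: CN.
      by move=> v v'; rewrite !ffunE => /kstar_inj/perm_inj.
    by rewrite ffunE tpermL (inj_eq kstar_inj).
  rewrite -big_distrr /= E_sum -mulrA mulrCA; apply: ler_wpM2l => //.
  rewrite /misses -expectZ; apply: le_expect => // w _.
  by rewrite /cumul big_distrr /=; apply: ler_sum => o _; exact: swap_hits_sum.
have KU : (K - U)%N = #|[pred k | k \notin codom kstar]|.
  have /card_codom := kstar_inj; rewrite card_ord => cU.
  have := cardC (mem (codom kstar)); rewrite cU card_ord => /esym K_eq.
  by apply/eqP; rewrite -(eqn_add2l U) -[X in (_ == X)%N]K_eq subnKC // K_eq
    leq_addr.
rewrite KU natrM -!mulrA; apply: ler_wpM2l => //.
rewrite mulrC mulr_natr -sumr_const.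
apply: (@le_trans _ _ (\sum_(k | k \notin codom kstar)
    kl * E t (cumul (raised_hits R kstar (redirect u k))))).
  apply: ler_sum => k kf; apply: CN.
    move=> v v'; rewrite !ffunE.
    case: eqP => [->|_]; case: eqP => [->//|_] e.
    - by case/negP: kf; rewrite e codom_f.
    - by case/negP: kf; rewrite -e codom_f.
    - exact: kstar_inj.
  rewrite ffunE eqxx; apply: contraNneq kf => ->; exact: codom_f.
rewrite -big_distrr /= E_sum; apply: ler_wpM2l => //.
by apply: E_le => o; exact: free_server_hits.
Qed.

Lemma missesS u t :
  misses u t.+1 = misses u t + miss_prob pol lam mu kstar u t.+1.
Proof. by apply: expect_cumulS => h; exact: obs_law_sum1. Qed.

End MissGrowth.

(** * Sequences with harmonic increments *)

Section HarmonicComparison.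
Variables (R : realType) (n p : nat -> R) (c : R) (N : nat).
Hypothesis nS : forall t, n t.+1 = n t + p t.+1.
Hypothesis p_le : forall t, (N < t)%N -> p t <= c / t%:R.

Lemma exists_nat_ge (x : R) : exists k : nat, x <= k%:R.
Proof.
exists (Num.truncn `|x|).+1; apply: le_trans (ler_norm _) _.
by apply/ltW; exact: truncnS_gt.
Qed.

(** Increments are eventually at most 1/16, and for large [t] the initial value fits in another
    [t / 16]. This supplies the smallness that the growth of misses presupposes. *)
Lemma harmonic_eighth : exists M : nat, forall t, (M <= t)%N -> n t <= t%:R / 8.
Proof.
have [k ck] := exists_nat_ge (16 * c).
pose N1 := maxn N k.
have lin j : n (N1 + j)%N <= n N1 + j%:R / 16.
  elim: j => [|j IH]; first by rewrite addn0 mul0r addr0.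
  rewrite addnS nS -natr1.
  have : p (N1 + j).+1 <= 1 / 16.
    apply: le_trans (p_le _) _; first by rewrite ltnS /N1; lia.
    rewrite ler_pdivrMr ?ltr0n //.
    have : k%:R <= (N1 + j).+1%:R :> R by rewrite ler_nat /N1; lia.
    by lra.
  by lra.
have [k' nk'] := exists_nat_ge (16 * n N1).
exists (maxn N1 k') => t; rewrite geq_max => /andP[N1t k't].
have := lin (t - N1)%N; rewrite subnKC //.
have : (t - N1)%:R <= t%:R :> R by rewrite ler_nat leq_subr.
have : k'%:R <= t%:R :> R by rewrite ler_nat.
by lra.
Qed.

Hypothesis c_ge0 : 0 <= c.

Lemma harmonic_ln : exists C : R, forall t, (N < t)%N -> n t <= C + c * ln t%:R.
Proof.
exists (n N.+1) => t Nt; rewrite -(subnKC Nt).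
elim: (t - N.+1)%N => [|j IH].
  by rewrite addn0 lerDl mulr_ge0 // ln_ge0 // ler1n.
rewrite addnS nS; set m := (N.+1 + j)%N in IH *.
have m0 : (0 < m)%N by rewrite /m addSn.
have mR : 0 < m%:R :> R by rewrite ltr0n.
have mR1 : 0 < m.+1%:R :> R by rewrite ltr0n.
(* The bound [ln (1 + x) <= x] at [x = - 1 / (m + 1)] makes the harmonic increments telescope. *)
have step : m.+1%:R^-1 <= ln m.+1%:R - ln m%:R :> R.
  have : ln (1 + - (m.+1%:R^-1)) <= - (m.+1%:R^-1) :> R.
    apply: le_ln1Dx; rewrite ltrN2 invf_lt1 // ltr1n //.
  have -> : 1 + - m.+1%:R^-1 = m%:R / m.+1%:R :> R.
    by rewrite -natr1; field; rewrite natr1 gt_eqF.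
  by rewrite ln_div ?posrE // lerNr opprB.
have pm : p m.+1 <= c / m.+1%:R by apply: p_le; rewrite /m; lia.
have := ler_wpM2l c_ge0 step; move: IH pm; rewrite mulrBr.
move: (n m) (p m.+1) (c * ln m%:R) (c * ln m.+1%:R) (c / m.+1%:R).
by move=> x y z w v; lra.
Qed.

Lemma harmonic_contra (b C : R) (M : nat) : c < b ->
  (forall t, (M <= t)%N -> b * ln t%:R - C <= n t) -> False.
Proof.
move=> cb low; have [C' up] := harmonic_ln.
(* Beyond this [k], [(b - c) * ln t] exceeds the two additive constants by at least 1. *)
have [k kx] := exists_nat_ge (expR ((C + C' + 1) / (b - c))).
pose t := maxn (maxn M N.+1) k.
have Mt : (M <= t)%N by rewrite /t; lia.
have Nt : (N < t)%N by rewrite /t; lia.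
have kt : k%:R <= t%:R :> R by rewrite ler_nat /t; lia.
have : (C + C' + 1) / (b - c) <= ln t%:R.
  rewrite -[leLHS]expRK ler_ln ?posrE ?expR_gt0 ?(le_trans kx) //.
  by rewrite ltr0n; lia.
rewrite ler_pdivrMr ?subr_gt0 //.
by have := low t Mt; have := up t Nt; lra.
Qed.

End HarmonicComparison.

(** * Bounds on the parameters of an instance *)

Section InstanceBounds.
Variables (U K : nat) (R : realType).
Variables (lam : 'I_U -> R) (mu : 'I_U -> 'I_K -> R) (kstar : 'I_U -> 'I_K).
Hypothesis inst_ok : instance_ok lam mu kstar.

Lemma lam_min_le u : lam_min lam <= lam u.
Proof. exact: bigmin_le_cond. Qed.

Lemma lam_min_ge0 : 0 <= lam_min lam.
Proof. by apply/bigmin_geP; split=> // u _; case/andP: (inst_ok.1 u). Qed.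

Lemma mu_min_le u k : mu_min mu <= mu u k.
Proof. exact: (bigmin_le_cond _ (fun p => mu p.1 p.2) (j := (u, k))). Qed.

Lemma mu_min_ge0 : 0 <= mu_min mu.
Proof. by apply/bigmin_geP; split=> // -[u k] _; case/andP: (inst_ok.2.1 u k). Qed.

Lemma le_mu_max u k : mu u k <= mu_max mu.
Proof. exact: (le_bigmax_cond _ (fun p => mu p.1 p.2) (j := (u, k))). Qed.

Lemma mu_max_le1 : mu_max mu <= 1.
Proof. by apply/bigmax_leP; split=> // -[u k] _; case/andP: (inst_ok.2.1 u k). Qed.

Lemma Delta_le u k : k != kstar u -> Delta mu kstar <= mu u (kstar u) - mu u k.
Proof.
exact: (bigmin_le_cond _ (fun p => mu p.1 (kstar p.1) - mu p.1 p.2) (j := (u, k))).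
Qed.

Lemma Delta_gt0 : 0 < Delta mu kstar.
Proof.
apply/bigmin_gtP; split=> // -[u k] /= ku.
by rewrite subr_gt0; exact: inst_ok.2.2.1.
Qed.

(** For an unassigned queue the loss is the whole best rate; comparing it with [Delta] takes a
    second server, as the minimum over an empty range would be the default 1. *)
Lemma Delta_missed u m : (1 < K)%N ->
  Delta mu kstar * missed R kstar u m <= mu u (kstar u) - rate mu m u.
Proof.
move=> K1; rewrite /missed /rate; case: (val m u) => [k|].
  rewrite (inj_eq (@Some_inj _)); have [->|ku] := eqVneq k (kstar u).
    by rewrite mulr0 subrr.
  by rewrite mulr1 Delta_le.
rewrite mulr1 subr0.
have /card_gt0P[k] : (0 < #|predC1 (kstar u)|)%N.
  by rewrite cardC1 card_ord -subn1 subn_gt0.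
rewrite !inE => ku.
apply: le_trans (Delta_le ku) _; rewrite gerBl.
by case/andP: (inst_ok.2.1 u k).
Qed.

Let q := (mu_max mu + 1) / 2.

(** Positivity excludes an infinite or zero divergence and so forces [mu_max < 1], which puts the
    midpoint strictly above all rates and below 1. *)
Lemma Dmu_gt0 : 0 < Dmu mu kstar ->
  [/\ q < 1, (forall u k, mu u k < q),
      0 < kl_bern (mu_min mu) q,
      (forall u k, kl_bern (mu u k) q <= kl_bern (mu_min mu) q)
    & Dmu mu kstar = Delta mu kstar / kl_bern (mu_min mu) q].
Proof.
rewrite /Dmu /KLb -/q; case: ifP; first by rewrite ltxx.
move=> /negbT; rewrite negb_or => /andP[_]; rewrite negb_and -leNgt.
move=> q1_or; rewrite -/(kl_bern (mu_min mu) q) => D0.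
have kl0 : 0 < kl_bern (mu_min mu) q.
  by move: D0; rewrite pmulr_rgt0 ?Delta_gt0 // invr_gt0.
(* If [q = 1], the divergence is infinite unless [mu_min = 1], and then it is zero. *)
have q_lt1 : q < 1.
  have q_le1 : q <= 1 by rewrite /q; have := mu_max_le1; lra.
  rewrite lt_def q_le1 andbT eq_sym; case/orP: q1_or => [//|min1].
  apply/negP => /eqP q1; move: kl0; rewrite /kl_bern q1.
  have -> : mu_min mu = 1.
    by apply/eqP; rewrite eq_le min1 andbT; exact: bigmin_le_id.
  by rewrite divr1 ln1 subrr mulr0 mul0r addr0 ltxx.
have mu_lt u k : mu u k < q.
  by have := le_mu_max u k; move: q_lt1; rewrite /q; lra.
split=> // u k; apply: kl_bern_anti => //; first exact: mu_min_ge0.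
exact: mu_min_le.
Qed.

Lemma rate_le_best u m : rate mu m u <= mu u (kstar u).
Proof.
rewrite /rate; case: (val m u) => [k|]; last by case/andP: (inst_ok.2.1 u (kstar u)).
by have [->//|/inst_ok.2.2.1/ltW] := eqVneq k (kstar u).
Qed.

End InstanceBounds.

(** * From the growth of misses to regret at infinitely many times *)

Section RegretRate.
Variables (U K : nat) (R : realType).
Variables (pol : policy U K R) (lam : 'I_U -> R) (mu : 'I_U -> 'I_K -> R).
Variables (kstar : 'I_U -> 'I_K) (pi : 'I_U -> nat -> R) (alpha : R).
Hypothesis pol_ok : valid_policy pol.
Hypothesis inst_ok : instance_ok lam mu kstar.
Hypothesis pi_stat : forall u, stationary (lam u) (mu u (kstar u)) (pi u).
Hypothesis alpha_lt1 : alpha < 1.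
Hypothesis pol_cons : consistent alpha pol.

Local Notation W := (maxn (U - 1) (2 * (K - U)))%N.
Local Notation kl := (kl_bern (mu_min mu) ((mu_max mu + 1) / 2)).

Lemma Psi_ge0 u t : (0 <= Psi pol lam mu kstar pi u t.+1)%E.
Proof.
have := @Psi_ge _ _ _ pol lam mu kstar pi pol_ok inst_ok pi_stat u 0 t (lexx _).
rewrite mulr0 mul0r; apply => m.
by rewrite mul0r subr_ge0; exact: rate_le_best inst_ok u m.
Qed.

Lemma Psi_ge_miss_prob u t : (1 < K)%N ->
  ((lam_min lam * Delta mu kstar * miss_prob pol lam mu kstar u t.+1)%:E
    <= Psi pol lam mu kstar pi u t.+1)%E.
Proof.
move=> K1; have D0 := ltW (Delta_gt0 inst_ok).
apply: le_trans (Psi_ge pol_ok inst_ok pi_stat t D0 _); last first.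
  by move=> m; exact: (Delta_missed inst_ok u m K1).
rewrite lee_fin ler_wpM2r ?miss_prob_ge0 // ler_wpM2r //.
exact: lam_min_le.
Qed.

Hypothesis D_gt0 : 0 < Dmu mu kstar.

Lemma misses_ln_ge u (c : R) (N : nat) :
  (forall t, (N < t)%N -> miss_prob pol lam mu kstar u t <= c / t%:R) ->
  exists CM : R * nat, forall t, (CM.2 <= t)%N ->
    W%:R * (3 * (1 - alpha) / (8 * kl)) * ln t%:R - CM.1
    <= misses pol lam mu kstar u t.
Proof.
move=> p_le; have [q1 mu_lt kl0 kl_ge _] := Dmu_gt0 inst_ok D_gt0.
have nS := missesS lam mu kstar pol_ok u.
have [M small] := harmonic_eighth nS p_le.
have [C [M' low]] := misses_growth pol_ok inst_ok q1 mu_lt (ltW kl0) kl_ge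
  alpha_lt1 pol_cons u.
exists (W%:R * C / (2 * kl), maxn M M') => t /=.
rewrite geq_max => /andP[Mt M't]; have {low small} := low t M't (small t Mt).
rewrite -ler_pdivrMl ?mulr_gt0 //; apply: le_trans.
rewrite le_eqVlt; apply/orP; left; apply/eqP.
by field; rewrite gt_eqF.
Qed.

Lemma Psi_frequently_ge u N : (1 < K)%N -> (0 < W)%N -> 0 < lam_min lam ->
  exists t, (N < t)%N /\
    (((lam_min lam / 8 * Dmu mu kstar * (1 - alpha) * W%:R) / t%:R)%:E
      <= Psi pol lam mu kstar pi u t)%E.
Proof.
move=> K1 W0 l0; apply: contrapT => /forallNP no.
have [q1 mu_lt kl0 kl_ge DE] := Dmu_gt0 inst_ok D_gt0.
have X0 : 0 < lam_min lam * Delta mu kstar.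
  by rewrite mulr_gt0 // (Delta_gt0 inst_ok).
(* This is the claimed constant divided by [lam_min * Delta], the factor between regret and miss
   probability. *)
pose c := W%:R * ((1 - alpha) / (8 * kl)).
have WR : 0 < W%:R :> R by rewrite ltr0n.
have a0 : 0 < (1 - alpha) / (8 * kl) by rewrite divr_gt0 ?subr_gt0 ?mulr_gt0.
have p_le t : (N < t)%N -> miss_prob pol lam mu kstar u t <= c / t%:R.
  case: t => // t Nt; rewrite -(ler_pM2l X0) -lee_fin.
  apply: le_trans (Psi_ge_miss_prob u t K1) _.
  have := no t.+1; rewrite Nt /= => /not_andP[//|/negP].
  rewrite -ltNge => /ltW/le_trans; apply.
  rewrite lee_fin DE /c le_eqVlt; apply/orP; left; apply/eqP.
  by field; rewrite nat1r pnatr_eq0 (gt_eqF kl0).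
have [[C M] low] := misses_ln_ge p_le.
apply: (harmonic_contra (missesS lam mu kstar pol_ok u) p_le _ _ low).
  by rewrite /c mulr_ge0 // ltW.
(* The growth of misses has slope [3 * c], from 3/4 over [2 * kl], which leaves strict room. *)
rewrite /c ltr_pM2l // [ltRHS](_ : _ = 3 * ((1 - alpha) / (8 * kl))).
  by lra.
by rewrite mulrA.
Qed.

Lemma mean_Psi_frequently_ge N : (0 < U)%N -> (U <= K)%N -> (1 < K)%N ->
  0 < lam_min lam ->
  exists t, (N < t)%N /\
    (((lam_min lam / 8 * Dmu mu kstar * (1 - alpha) * (K - 1)%:R) / t%:R)%:E
      <= (U%:R^-1)%:E * \sum_(u < U) Psi pol lam mu kstar pi u t)%E.
Proof.
move=> U0 UK K1 l0; apply: contrapT => /forallNP no.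
have [q1 mu_lt kl0 kl_ge DE] := Dmu_gt0 inst_ok D_gt0.
have X0 : 0 < lam_min lam * Delta mu kstar.
  by rewrite mulr_gt0 // (Delta_gt0 inst_ok).
pose c := (K - 1)%:R * ((1 - alpha) / (8 * kl)).
have a0 : 0 < (1 - alpha) / (8 * kl) by rewrite divr_gt0 ?subr_gt0 ?mulr_gt0.
have UR : 0 < U%:R :> R by rewrite ltr0n.
pose p t := U%:R^-1 * \sum_(u < U) miss_prob pol lam mu kstar u t.
pose n t := U%:R^-1 * \sum_(u < U) misses pol lam mu kstar u t.
have nS t : n t.+1 = n t + p t.+1.
  rewrite /n /p -mulrDr -big_split /=; congr (_ * _).
  by apply: eq_bigr => u _; exact: missesS.
have p_le t : (N < t)%N -> p t <= c / t%:R.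
  case: t => // t Nt; rewrite -(ler_pM2l X0) -lee_fin.
  apply: (@le_trans _ _ ((U%:R^-1)%:E
      * \sum_(u < U) Psi pol lam mu kstar pi u t.+1)%E).
    rewrite /p mulrCA mulr_sumr EFinM -sumEFin.
    apply: lee_wpmul2l; first by rewrite lee_fin invr_ge0 ltW.
    by apply: lee_sum => u _; exact: Psi_ge_miss_prob.
  have := no t.+1; rewrite Nt /= => /not_andP[//|/negP].
  rewrite -ltNge => /ltW/le_trans; apply.
  rewrite lee_fin DE /c le_eqVlt; apply/orP; left; apply/eqP.
  by field; rewrite nat1r pnatr_eq0 (gt_eqF kl0).
(* Miss probabilities are nonnegative, so a bound on the average bounds each queue up to a factor
   [U]; this is enough to apply the growth bound queue by queue. *)
have pu_le u t : (N < t)%N ->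
    miss_prob pol lam mu kstar u t <= (U%:R * c) / t%:R.
  move=> Nt; rewrite -mulrA -ler_pdivrMl //; apply: le_trans (p_le t Nt).
  rewrite ler_pM2l ?invr_gt0 // (bigD1 u) //= lerDl sumr_ge0 // => v _.
  exact: miss_prob_ge0.
have /fin_all_exists[CM low] u := misses_ln_ge (pu_le u).
pose b : R := W%:R * (3 * (1 - alpha) / (8 * kl)).
have n_ge t : (\max_u (CM u).2 <= t)%N ->
    b * ln t%:R - U%:R^-1 * \sum_u (CM u).1 <= n t.
  move=> Mt; rewrite /n -(ler_pM2l UR) mulrBr !mulVKf ?gt_eqF //.
  have -> : U%:R * (b * ln t%:R) = \sum_(u < U) b * ln t%:R.
    by rewrite sumr_const card_ord mulr_natl.
  rewrite -sumrB.
  apply: ler_sum => u _; apply: low; apply: leq_trans Mt.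
  exact: (leq_bigmax u).
apply: (harmonic_contra nS p_le _ _ n_ge).
  by rewrite /c mulr_ge0 // ltW.
rewrite /c /b [ltRHS](_ : _ = (3 * W)%:R * ((1 - alpha) / (8 * kl))).
  (* [K - 1] splits as [(U - 1) + (K - U)], at most 3/2 of the maximum [W], and [W] is positive
     because [K > 1]. *)
  by rewrite ltr_pM2r // ltr_nat; lia.
by rewrite natrM; ring.
Qed.

End RegretRate.

(** * Both regret bounds, with degenerate constants treated apart *)

Theorem theorem5 (U K : nat) (R : realType)
  (lam : 'I_U -> R) (mu : 'I_U -> 'I_K -> R) (kstar : 'I_U -> 'I_K)
  (pi : 'I_U -> nat -> R) (alpha : R) (pol : policy U K R) :
  (1 <= U)%N -> (U <= K)%N ->
  instance_ok lam mu kstar ->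
  (forall u, stationary (lam u) (mu u (kstar u)) (pi u)) ->
  0 < alpha < 1 ->
  valid_policy pol -> consistent alpha pol ->
  (forall N : nat, exists t : nat, (N < t)%N /\
     ((lam_min lam / 8 * Dmu mu kstar * (1 - alpha) * (K - 1)%:R) / t%:R)%:E
       <= (U%:R^-1)%:E * \sum_(u < U) Psi pol lam mu kstar pi u t)%E
  /\
  (forall u : 'I_U, forall N : nat, exists t : nat, (N < t)%N /\
     ((lam_min lam / 8 * Dmu mu kstar * (1 - alpha)
        * (maxn (U - 1) (2 * (K - U)))%:R) / t%:R)%:E
       <= Psi pol lam mu kstar pi u t)%E.
Proof.
move=> U1 UK ok st /andP[_ alpha1] pol_ok cons.
have l_ge0 := lam_min_ge0 ok.
(* A constant that is not positive makes the claim follow from nonnegative regret at time [N.+1]; a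
   positive one rules out all degenerate parameters. *)
have pos (w : nat) : 0 < lam_min lam / 8 * Dmu mu kstar * (1 - alpha) * w%:R ->
    [/\ (0 < w)%N, 0 < lam_min lam & 0 < Dmu mu kstar].
  case: w => [|w]; first by rewrite mulr0 ltxx.
  rewrite pmulr_lgt0 ?ltr0n // pmulr_lgt0 ?subr_gt0 // => h.
  have l0 : 0 < lam_min lam.
    rewrite lt_def l_ge0 andbT; apply/eqP => l0.
    by move: h; rewrite l0 !mul0r ltxx.
  by split=> //; move: h; rewrite pmulr_rgt0 // divr_gt0.
split=> [N|u N].
  have [/pos[K1 l0 D0]|c_le0] := ltP 0 (lam_min lam / 8 * Dmu mu kstar
    * (1 - alpha) * (K - 1)%:R).
    by apply: mean_Psi_frequently_ge => //; rewrite -subn_gt0.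
  exists N.+1; split=> //; apply: (@le_trans _ _ 0%E).
    by rewrite lee_fin pmulr_lle0 // invr_gt0 ltr0n.
  apply: mule_ge0; first by rewrite lee_fin invr_ge0 ler0n.
  by apply: sume_ge0 => u _; exact: Psi_ge0.
have [/pos[W0 l0 D0]|c_le0] := ltP 0 (lam_min lam / 8 * Dmu mu kstar
  * (1 - alpha) * (maxn (U - 1) (2 * (K - U)))%:R).
  by apply: Psi_frequently_ge => //; lia.
exists N.+1; split=> //; apply: (@le_trans _ _ 0%E).
  by rewrite lee_fin pmulr_lle0 // invr_gt0 ltr0n.
exact: Psi_ge0.
Qed.
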